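(* Let $M,\rho,l,k,T_0,Q>0$ and $\beta\ge 0$, put $\Omega_T=\frac{\pi}{2l}\sqrt{T_0/\rho}$, and consider the system for real functions $u(t),w(t)$ with no damping associated with the transverse (lateral) oscillations: $$M\ddot u+\beta\dot u+T_1(t)=Q\cos\omega t,\qquad \rho\,\ddot w+\frac{\pi^2}{4l^2}\,T(t)\,w=0,$$ $$T(t)=T_0+T_1(t),\qquad T_1(t)=k\Big(u(t)+\frac{\pi^2}{16 l}w(t)^2\Big).$$ In the case of resonance excitation, $\omega=2\Omega_T$, there is an elementary exact solution of this system in which the tensile force is invariable, $T(t)\equiv T_0$, that is, $T_1\equiv 0$ (so that $u,w$ satisfy $M\ddot u+\beta\dot u=Q\cos\omega t$ and $\rho\ddot w+\frac{\pi^2}{4l^2}T_0w=0$). It consists of oscillating displacements with a constant (negative) shift of $u$: $$u(t)=-\frac{Q}{\omega(M^2\omega^2+\beta^2)}\Big(M\omega\cos\omega t-\beta\sin\omega t+\sqrt{M^2\omega^2+\beta^2}\Big),$$ $$w(t)=A\cos\frac{\omega t}{2}+B\sin\frac{\omega t}{2},\qquad T_1(t)=0,$$ where $$A=\sqrt{\big(\sqrt{M^2\omega^2+\beta^2}+M\omega\big)\psi},\qquad B=\sqrt{\big(\sqrt{M^2\omega^2+\beta^2}-M\omega\big)\psi},\qquad \psi=\frac{16 lQ}{\pi^2\omega(M^2\omega^2+\beta^2)}.$$ The maxima are $$(-u)_{\max}=\frac{2Q}{\omega\sqrt{M^2\omega^2+\beta^2}},\qquad w_{\max}=\frac4\pi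\sqrt{\frac{2lQ}{\omega\sqrt{M^2\omega^2+\beta^2}}}=\frac4\pi\sqrt{l\,(-u)_{\max}}.$$
   Context: The system models two equal masses $M$ (moving symmetrically, with displacements $u(t)$ and $-u(t)$) connected by an elastic string of length $2l$, mass per unit length $\rho$, stiffness $k/2$ and initial tensile force $T_0$; $w(t)$ is the transverse displacement of the string's midpoint. $Q$ and $\omega$ are the amplitude and frequency of the external longitudinal harmonic force, $\beta$ is the viscosity number associated with the longitudinal oscillations, $T$ is the total tensile force in the string, and $\Omega_T$ is the frequency of small free transverse oscillations. Dots denote time derivatives.
   Formalization: The sign of the sine term of w is corrected: w(t) = A cos(ωt/2) − B sin(ωt/2) instead of A cos(ωt/2) + B sin(ωt/2), since with the printed plus sign T_1 = 2kβQ sin(ωt)/(ω(M²ω²+β²)), which is not zero for β > 0. *)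

(* Defs.v *)
From Stdlib Require Import Reals.
From Coquelicot Require Import Coquelicot.
Open Scope R_scope.

Definition Omega_T (rho l T0 : R) : R := PI / (2 * l) * sqrt (T0 / rho).

Definition T_1 (k l : R) (u w : R -> R) (t : R) : R :=
  k * (u t + PI ^ 2 / (16 * l) * (w t) ^ 2).

Definition tension (k l T0 : R) (u w : R -> R) (t : R) : R :=
  T0 + T_1 k l u w t.

(* [Derive] and [Derive_n] are total, so differentiability has to be required
   separately for the equations of motion to be meaningful. *)
Definition twice_differentiable (f : R -> R) : Prop :=
  forall t : R, ex_derive_n f 1 t /\ ex_derive_n f 2 t.

Definition is_motion (M rho l k T0 Q beta omega : R) (u w : R -> R) : Prop :=
  twice_differentiable u /\ twice_differentiable w /\
  forall t : R,
    M * Derive_n u 2 t + beta * Derive u t + T_1 k l u w t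
      = Q * cos (omega * t) /\
    rho * Derive_n w 2 t + PI ^ 2 / (4 * l ^ 2) * tension k l T0 u w t * w t = 0.

Definition S_amp (M beta omega : R) : R := sqrt (M ^ 2 * omega ^ 2 + beta ^ 2).

Definition psi (M l Q beta omega : R) : R :=
  16 * l * Q / (PI ^ 2 * omega * (M ^ 2 * omega ^ 2 + beta ^ 2)).

Definition A_amp (M l Q beta omega : R) : R :=
  sqrt ((S_amp M beta omega + M * omega) * psi M l Q beta omega).

Definition B_amp (M l Q beta omega : R) : R :=
  sqrt ((S_amp M beta omega - M * omega) * psi M l Q beta omega).

Definition u_exact (M Q beta omega : R) (t : R) : R :=
  - (Q / (omega * (M ^ 2 * omega ^ 2 + beta ^ 2)))
  * (M * omega * cos (omega * t) - beta * sin (omega * t) + S_amp M beta omega).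

(* The sine coefficient is minus the nonnegative root [B_amp].
   With C and D the coefficients of cos (omega t / 2) and sin (omega t / 2), the
   sin (omega t) component of w^2 is C * D, and cancelling that of [u_exact] in
   [T_1] requires C * D = - beta * psi, whereas A_amp * B_amp = beta * psi.
   So the two roots must be taken with opposite signs; the plus sign would give
   T_1 = 2 k beta Q / (omega (M^2 omega^2 + beta^2)) * sin (omega t),
   which vanishes identically only for beta = 0. *)
Definition w_exact (M l Q beta omega : R) (t : R) : R :=
  A_amp M l Q beta omega * cos (omega * t / 2)
  - B_amp M l Q beta omega * sin (omega * t / 2).

Definition is_maximum (f : R -> R) (m : R) : Prop :=
  (exists t : R, f t = m) /\ (forall t : R, f t <= m).

(* Main.v *)
Require Import Defs.
From Stdlib Require Import Reals Lra.
From Coquelicot Require Import Coquelicot.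
Open Scope R_scope.

(** With [c = Q / (omega S^2)], so that [psi = 16 l c / PI^2], the relations
    [A^2 = (S + M omega) psi], [B^2 = (S - M omega) psi] and [A B = beta psi]
    and the half-angle formulas give
    [w^2 = psi (M omega cos (omega t) - beta sin (omega t) + S) = - (16 l / PI^2) u],
    i.e. [T_1 = 0]. The two equations then decouple into a linear forced equation
    and a harmonic oscillator. Both maxima are amplitudes [sqrt (a^2 + b^2)] of
    functions [a cos x - b sin x]. *)

(** * Calculus of a sinusoid with constant shift *)

Definition harmonic (a b c nu t : R) : R :=
  a * cos (nu * t) + b * sin (nu * t) + c.

Lemma is_derive_harmonic (a b c nu t : R) :
  is_derive (harmonic a b c nu) t (harmonic (b * nu) (- a * nu) 0 nu t).
Proof.
unfold harmonic; auto_derive; [exact I | ring].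
Qed.

(** The hypothesis is pointwise, so the rule applies to [u_exact] and [w_exact], and once more to
    their [Derive], without any equality between functions. *)
Lemma is_derive_eq_harmonic (f : R -> R) (a b c nu t : R) :
  (forall s, f s = harmonic a b c nu s) ->
  is_derive f t (harmonic (b * nu) (- a * nu) 0 nu t).
Proof.
intros Hf; apply is_derive_ext with (harmonic a b c nu).
- intros s; symmetry; apply Hf.
- apply is_derive_harmonic.
Qed.

Lemma Derive_eq_harmonic (f : R -> R) (a b c nu t : R) :
  (forall s, f s = harmonic a b c nu s) ->
  Derive f t = harmonic (b * nu) (- a * nu) 0 nu t.
Proof.
intros Hf; apply is_derive_unique, (is_derive_eq_harmonic f a b c); exact Hf.
Qed.

Lemma is_derive_Derive_eq_harmonic (f : R -> R) (a b c nu t : R) :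
  (forall s, f s = harmonic a b c nu s) ->
  is_derive (Derive f) t (harmonic (- a * nu * nu) (- (b * nu) * nu) 0 nu t).
Proof.
intros Hf; apply (is_derive_eq_harmonic (Derive f) (b * nu) (- a * nu) 0).
intros s; apply (Derive_eq_harmonic f a b c); exact Hf.
Qed.

Lemma Derive2_eq_harmonic (f : R -> R) (a b c nu t : R) :
  (forall s, f s = harmonic a b c nu s) ->
  Derive_n f 2 t = harmonic (- a * nu * nu) (- (b * nu) * nu) 0 nu t.
Proof.
intros Hf; change (Derive_n f 2 t) with (Derive (Derive f) t).
apply is_derive_unique, (is_derive_Derive_eq_harmonic f a b c); exact Hf.
Qed.

Lemma twice_differentiable_eq_harmonic (f : R -> R) (a b c nu : R) :
  (forall s, f s = harmonic a b c nu s) -> twice_differentiable f.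
Proof.
intros Hf t; split.
- eexists; apply (is_derive_eq_harmonic f a b c nu t Hf).
- change (ex_derive (Derive f) t).
  eexists; apply (is_derive_Derive_eq_harmonic f a b c nu t Hf).
Qed.

(** The oscillating part has a periodic antiderivative, so only [c] survives; this identifies [c] as
    the mean value, hence as the constant shift. *)
Lemma is_RInt_harmonic_period (a b c nu : R) :
  nu <> 0 ->
  is_RInt (harmonic a b c nu) 0 (2 * PI / nu) (2 * PI / nu * c).
Proof.
intros Hnu.
set (F := fun t => a / nu * sin (nu * t) - b / nu * cos (nu * t) + c * t).
replace (2 * PI / nu * c) with (minus (F (2 * PI / nu)) (F 0)).
- apply (is_RInt_derive F).
  + intros t _; unfold F, harmonic; auto_derive; [exact I | now field].
  + intros t _; apply (ex_derive_continuous (harmonic a b c nu)).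
    eexists; apply is_derive_harmonic.
- unfold F, minus, plus, opp; simpl.
  replace (nu * (2 * PI / nu)) with (2 * PI) by now field.
  rewrite Rmult_0_r, sin_2PI, cos_2PI, sin_0, cos_0; now field.
Qed.

(** * Amplitude of [a * cos x - b * sin x] *)

Lemma cos_sin_amplitude_le (a b r x : R) :
  0 <= r -> a ^ 2 + b ^ 2 = r ^ 2 -> a * cos x - b * sin x <= r.
Proof.
intros Hr Hab; apply Rsqr_incr_0_var; [|exact Hr].
pose proof (sin2_cos2 x) as H1; unfold Rsqr in *.
(* Rotation by [x] preserves [a ^ 2 + b ^ 2]; the second rotated coordinate is then dropped as a
   square. *)
assert (r * r = (a * cos x - b * sin x) * (a * cos x - b * sin x)
  + (a * sin x + b * cos x) ^ 2) as ->.
{ transitivity (r ^ 2 * (sin x * sin x + cos x * cos x)).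
  - rewrite H1; ring.
  - rewrite <- Hab; ring. }
pose proof (pow2_ge_0 (a * sin x + b * cos x)); lra.
Qed.

Lemma cos_sin_amplitude_attained (a b r : R) :
  0 < r -> 0 <= b -> a ^ 2 + b ^ 2 = r ^ 2 ->
  exists x, a * cos x - b * sin x = r.
Proof.
intros Hr Hb Hab.
assert (Ha : -1 <= a / r <= 1).
{ assert (a <= r /\ - r <= a) as [H1 H2] by nra.
  split; [apply Rle_div_r | apply Rle_div_l]; lra. }
(* Here [cos x = a / r] and [sin x = - (b / r)], the latter because [0 <= b] makes [b / r] the
   nonnegative root; the value is [(a ^ 2 + b ^ 2) / r = r]. *)
exists (- acos (a / r)).
rewrite cos_neg, sin_neg, cos_acos, sin_acos by exact Ha.
replace (1 - Rsqr (a / r)) with (Rsqr (b / r)).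
- rewrite sqrt_Rsqr by (apply Rdiv_le_0_compat; assumption).
  transitivity ((a ^ 2 + b ^ 2) / r); [field; lra | rewrite Hab; field; lra].
- transitivity ((r ^ 2 - a ^ 2) / r ^ 2); [|unfold Rsqr; field; lra].
  replace (r ^ 2 - a ^ 2) with (b ^ 2) by lra; unfold Rsqr; field; lra.
Qed.

(** * Amplitude relations, equations of motion and maxima for a given [omega > 0] *)

Section Amplitudes.

Variables M l Q beta omega : R.
Hypotheses (HM : 0 < M) (Hl : 0 < l) (HQ : 0 < Q) (Hbeta : 0 <= beta)
  (Homega : 0 < omega).

Let S := S_amp M beta omega.
Let A := A_amp M l Q beta omega.
Let B := B_amp M l Q beta omega.
Let p := psi M l Q beta omega.

Lemma S_amp_sqr : S ^ 2 = M ^ 2 * omega ^ 2 + beta ^ 2.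
Proof.
unfold S, S_amp; apply pow2_sqrt; nra.
Qed.

Lemma S_amp_ge : M * omega <= S.
Proof.
pose proof (Rmult_lt_0_compat _ _ HM Homega).
apply Rsqr_incr_0_var; [|apply sqrt_pos].
pose proof S_amp_sqr; unfold Rsqr; nra.
Qed.

Lemma S_amp_gt0 : 0 < S.
Proof.
pose proof (Rmult_lt_0_compat _ _ HM Homega); pose proof S_amp_ge; lra.
Qed.

Lemma psi_eq : p = 16 * l * Q / (PI ^ 2 * omega * S ^ 2).
Proof.
unfold p, psi; now rewrite S_amp_sqr.
Qed.

Lemma psi_gt0 : 0 < p.
Proof.
rewrite psi_eq; pose proof PI_RGT_0; pose proof S_amp_gt0.
apply Rdiv_lt_0_compat; [repeat apply Rmult_lt_0_compat; lra |].
repeat match goal with |- 0 < _ * _ => apply Rmult_lt_0_compat end;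
  try apply pow_lt; lra.
Qed.

Lemma A_amp_sqr : A ^ 2 = (S + M * omega) * p.
Proof.
pose proof (Rmult_lt_0_compat _ _ HM Homega).
apply pow2_sqrt, Rmult_le_pos; [pose proof S_amp_gt0 | pose proof psi_gt0];
  unfold S, p in *; lra.
Qed.

Lemma B_amp_sqr : B ^ 2 = (S - M * omega) * p.
Proof.
apply pow2_sqrt, Rmult_le_pos; [pose proof S_amp_ge | pose proof psi_gt0];
  unfold S, p in *; lra.
Qed.

(** Both sides are nonnegative, so squares suffice: [(S + M * omega) * (S - M * omega) = beta ^
    2]. *)
Lemma A_amp_mul_B_amp : A * B = beta * p.
Proof.
assert (HA : 0 <= A) by apply sqrt_pos.
assert (HB : 0 <= B) by apply sqrt_pos.
pose proof psi_gt0 as Hp.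
apply Rsqr_inj; [nra | nra |].
transitivity (A ^ 2 * B ^ 2); [unfold Rsqr; ring |].
rewrite A_amp_sqr, B_amp_sqr.
transitivity ((S ^ 2 - M ^ 2 * omega ^ 2) * p ^ 2); [ring |].
rewrite S_amp_sqr; unfold Rsqr; ring.
Qed.

(** The squared terms give [p * (S + M * omega * cos (2 * x))] and the cross term, negative by the
    sign choice in [w_exact], gives [- p * beta * sin (2 * x)]. *)
Lemma w_exact_sqr (t : R) :
  w_exact M l Q beta omega t ^ 2
  = p * (M * omega * cos (omega * t) - beta * sin (omega * t) + S).
Proof.
unfold w_exact; fold A B.
set (x := omega * t / 2).
replace (omega * t) with (2 * x) by (unfold x; field).
rewrite sin_2a, cos_2a.
transitivity (A ^ 2 * (cos x * cos x) + B ^ 2 * (sin x * sin x)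
  - 2 * (A * B) * (sin x * cos x)); [ring |].
rewrite A_amp_sqr, B_amp_sqr, A_amp_mul_B_amp.
pose proof (sin2_cos2 x) as H1; unfold Rsqr in H1.
replace (cos x * cos x) with (1 - sin x * sin x) by lra; ring.
Qed.

(** The factor of [psi] is chosen so that [PI ^ 2 / (16 * l) * p = Q / (omega * S ^ 2)], the
    prefactor in [u_exact]; the string then keeps its initial tension. *)
Lemma u_exact_eq_w_exact (t : R) :
  u_exact M Q beta omega t
  = - (PI ^ 2 / (16 * l) * w_exact M l Q beta omega t ^ 2).
Proof.
rewrite w_exact_sqr, psi_eq; unfold u_exact; rewrite <- S_amp_sqr; fold S.
pose proof PI_RGT_0; pose proof S_amp_gt0; field; repeat split; lra.
Qed.

Lemma u_exact_harmonic (t : R) :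
  u_exact M Q beta omega t
  = harmonic (- (Q * M / S ^ 2)) (Q * beta / (omega * S ^ 2))
      (- (Q / (omega * S))) omega t.
Proof.
unfold u_exact, harmonic; rewrite <- S_amp_sqr; fold S.
pose proof S_amp_gt0; field; split; lra.
Qed.

Lemma w_exact_harmonic (t : R) :
  w_exact M l Q beta omega t = harmonic A (- B) 0 (omega / 2) t.
Proof.
unfold w_exact, harmonic; fold A B.
replace (omega / 2 * t) with (omega * t / 2) by field; ring.
Qed.

Lemma u_exact_equation (t : R) :
  M * Derive_n (u_exact M Q beta omega) 2 t
    + beta * Derive (u_exact M Q beta omega) t = Q * cos (omega * t).
Proof.
rewrite (Derive2_eq_harmonic _ _ _ _ _ t u_exact_harmonic).
rewrite (Derive_eq_harmonic _ _ _ _ _ t u_exact_harmonic).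
pose proof S_amp_gt0.
(* The sine terms of [M * u''] and [beta * u'] cancel; the cosine coefficients add up to this
   one. *)
transitivity (Q * (M ^ 2 * omega ^ 2 + beta ^ 2) / S ^ 2 * cos (omega * t)).
- unfold harmonic; field; split; lra.
- rewrite <- S_amp_sqr; field; lra.
Qed.

Lemma w_exact_equation (t : R) :
  Derive_n (w_exact M l Q beta omega) 2 t
  = - (omega ^ 2 / 4) * w_exact M l Q beta omega t.
Proof.
rewrite (Derive2_eq_harmonic _ _ _ _ _ t w_exact_harmonic), w_exact_harmonic.
unfold harmonic; field.
Qed.

Lemma is_maximum_opp_u_exact :
  is_maximum (fun t => - u_exact M Q beta omega t) (2 * Q / (omega * S)).
Proof.
pose proof S_amp_gt0 as HS.
assert (Hab : (M * omega) ^ 2 + beta ^ 2 = S ^ 2) by (rewrite S_amp_sqr; ring).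
assert (Hu : forall t, - u_exact M Q beta omega t
  = Q / (omega * S ^ 2)
    * (M * omega * cos (omega * t) - beta * sin (omega * t) + S)).
{ intros t; unfold u_exact; rewrite <- S_amp_sqr; fold S; ring. }
(* One [S] is the amplitude of the oscillating part, the other is the constant shift. *)
replace (2 * Q / (omega * S)) with (Q / (omega * S ^ 2) * (S + S))
  by (field; split; lra).
split.
- destruct (cos_sin_amplitude_attained _ _ _ HS Hbeta Hab) as [x Hx].
  exists (x / omega); rewrite Hu.
  replace (omega * (x / omega)) with x by (field; lra); now rewrite Hx.
- intros t; rewrite Hu; apply Rmult_le_compat_l.
  + apply Rlt_le, Rdiv_lt_0_compat; [lra |].
    apply Rmult_lt_0_compat; [lra | now apply pow_lt].
  + apply Rplus_le_compat_r, cos_sin_amplitude_le; [lra | exact Hab].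
Qed.

Lemma is_maximum_w_exact :
  is_maximum (w_exact M l Q beta omega)
    (4 / PI * sqrt (2 * l * Q / (omega * S))).
Proof.
pose proof S_amp_gt0 as HS; pose proof PI_RGT_0 as HPI.
assert (Hq : 0 < 2 * l * Q / (omega * S)).
{ apply Rdiv_lt_0_compat; repeat apply Rmult_lt_0_compat; lra. }
set (r := 4 / PI * sqrt (2 * l * Q / (omega * S))).
assert (Hr : 0 < r).
{ apply Rmult_lt_0_compat; [apply Rdiv_lt_0_compat; lra | now apply sqrt_lt_R0]. }
(* Both sides equal [2 * S * p], since [M * omega] cancels in the sum of the squared amplitudes. *)
assert (Hab : A ^ 2 + B ^ 2 = r ^ 2).
{ unfold r; rewrite A_amp_sqr, B_amp_sqr, psi_eq, Rpow_mult_distr, pow2_sqrt by lra.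
  field; repeat split; lra. }
split.
- destruct (cos_sin_amplitude_attained A B r Hr (sqrt_pos _) Hab) as [x Hx].
  exists (2 * x / omega); unfold w_exact; fold A B.
  now replace (omega * (2 * x / omega) / 2) with x by (field; lra).
- intros t; apply cos_sin_amplitude_le; [lra | exact Hab].
Qed.

End Amplitudes.

(** * Frequency of free transverse oscillations *)

Lemma Omega_T_gt0 (rho l T0 : R) :
  0 < rho -> 0 < l -> 0 < T0 -> 0 < Omega_T rho l T0.
Proof.
intros Hrho Hl HT0; pose proof PI_RGT_0.
apply Rmult_lt_0_compat; [apply Rdiv_lt_0_compat; lra |].
apply sqrt_lt_R0, Rdiv_lt_0_compat; lra.
Qed.

Lemma Omega_T_sqr (rho l T0 : R) :
  0 < rho -> 0 < l -> 0 < T0 ->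
  rho * Omega_T rho l T0 ^ 2 = PI ^ 2 / (4 * l ^ 2) * T0.
Proof.
intros Hrho Hl HT0; unfold Omega_T.
rewrite Rpow_mult_distr, pow2_sqrt by (apply Rlt_le, Rdiv_lt_0_compat; lra).
field; split; lra.
Qed.

(** * The exact solution at resonance *)

Theorem mainTheorem1 :
  forall M rho l k T0 Q beta omega : R,
    0 < M -> 0 < rho -> 0 < l -> 0 < k -> 0 < T0 -> 0 < Q -> 0 <= beta ->
    omega = 2 * Omega_T rho l T0 ->
    let u := u_exact M Q beta omega in
    let w := w_exact M l Q beta omega in
    let S := S_amp M beta omega in
    let u_max := 2 * Q / (omega * S) in
    let w_max := 4 / PI * sqrt (2 * l * Q / (omega * S)) in
    is_motion M rho l k T0 Q beta omega u w /\
    (forall t : R, T_1 k l u w t = 0) /\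
    (forall t : R, tension k l T0 u w t = T0) /\
    (forall t : R,
       M * Derive_n u 2 t + beta * Derive u t = Q * cos (omega * t) /\
       rho * Derive_n w 2 t + PI ^ 2 / (4 * l ^ 2) * T0 * w t = 0) /\
    (* the constant shift of u, as its mean value over a period *)
    - (Q / (omega * S)) < 0 /\
    is_RInt u 0 (2 * PI / omega) (2 * PI / omega * - (Q / (omega * S))) /\
    is_maximum (fun t : R => - u t) u_max /\
    is_maximum w w_max /\
    w_max = 4 / PI * sqrt (l * u_max).
Proof.
intros M rho l k T0 Q beta omega HM Hrho Hl Hk HT0 HQ Hbeta Homega_eq u w S u_max w_max.
assert (Homega : 0 < omega).
{ pose proof (Omega_T_gt0 rho l T0 Hrho Hl HT0); lra. }
assert (HS : 0 < S) by now apply S_amp_gt0.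
assert (HT1 : forall t, T_1 k l u w t = 0).
{ intros t; unfold T_1, u, w; rewrite (u_exact_eq_w_exact M l) by assumption; ring. }
assert (HT : forall t, tension k l T0 u w t = T0).
{ intros t; unfold tension; rewrite HT1; ring. }
assert (Hequ : forall t,
  M * Derive_n u 2 t + beta * Derive u t = Q * cos (omega * t)).
{ intros t; now apply u_exact_equation. }
assert (Heqw : forall t,
  rho * Derive_n w 2 t + PI ^ 2 / (4 * l ^ 2) * T0 * w t = 0).
{ intros t; unfold w; rewrite w_exact_equation.
  (* Resonance makes the frequency [omega / 2] of [w] equal to [Omega_T], the natural frequency at
     tension [T0]. *)
  rewrite <- (Omega_T_sqr rho), Homega_eq by assumption; field. }
assert (Hu : forall t, u t = harmonic (- (Q * M / S ^ 2))
  (Q * beta / (omega * S ^ 2)) (- (Q / (omega * S))) omega t).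
{ intros t; now apply u_exact_harmonic. }
unfold is_motion; repeat match goal with |- _ /\ _ => split end.
- exact (twice_differentiable_eq_harmonic _ _ _ _ _ Hu).
- exact (twice_differentiable_eq_harmonic _ _ _ _ _ (w_exact_harmonic M l Q beta omega)).
- intros t; split.
  + rewrite HT1, Rplus_0_r; apply Hequ.
  + rewrite HT; apply Heqw.
- exact HT1.
- exact HT.
- intros t; split; [apply Hequ | apply Heqw].
- apply Ropp_lt_gt_0_contravar, Rdiv_lt_0_compat; [lra |].
  now apply Rmult_lt_0_compat.
- apply (is_RInt_ext _ _ _ _ _ (fun t _ => eq_sym (Hu t))).
  apply is_RInt_harmonic_period; lra.
- now apply is_maximum_opp_u_exact.
- now apply is_maximum_w_exact.
(* The two radicands agree: [l * u_max = 2 * l * Q / (omega * S)]. *)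
- unfold w_max, u_max; do 2 f_equal; field; lra.
Qed.
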